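(* Let $B$ be a space with basepoint. Then the loop space $\mathbf{Top}_*(S^1,B)$ is a homotopy monoid in $\mathbf{Top}$, in a canonical way.
   Context: ''Space'' means compactly generated Hausdorff space (or an object of some other convenient cartesian closed substitute for the category of topological spaces). $\mathbf{Top}$ is the category of spaces, monoidal under the cartesian product $\times$, with unit the one-point space $1$. $\mathbf{Top}_*$ is the category of spaces with basepoint and continuous basepoint-preserving maps, and $\mathbf{Top}_*(S^1,B)$ is the space of continuous basepoint-preserving maps from the circle $S^1$ to $B$. $\Delta$ is the category of finite ordinals, equivalent to the category of totally ordered finite sets (including $\emptyset$) and order-preserving maps. Its objects are written $0,1,\dots$, so that $n$ denotes an $n$-element totally ordered set. It is monoidal under addition $+$, with unit object the empty set $0$. A colax monoidal functor $(X,\xi):\mathcal{N}'\to\mathcal{N}$ between monoidal categories (with tensor $\otimes$ and unit $I$ in each) is a functor $X:\mathcal{N}'\to\mathcal{N}$ together with maps $\xi_{A,B}:X(A\otimes B)\to X(A)\otimes X(B)$, natural in $A,B\in\mathcal{N}'$, and a map $\xi_0:X(I)\to I$, satisfying the following coherence axioms. (Coassociativity) The two composites $X((A\otimes B)\otimes D)\to X(A)\otimes(X(B)\otimes X(D))$, namely $\xi_{A\otimes B,D}$ followed by $\xi_{A,B}\otimes 1$ followed by the associativity isomorphism of $\mathcal{N}$, and $X$ of the associativity isomorphism of $\mathcal{N}'$ followed by $\xi_{A,B\otimes D}$ followed by $1\otimes\xi_{B,D}$, are equal. (Counit) The composite $X(I\otimes A)\xrightarrow{\xi_{I,A}}X(I)\otimes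 X(A)\xrightarrow{\xi_0\otimes 1}I\otimes X(A)\cong X(A)$ equals $X$ of the left unit isomorphism $I\otimes A\cong A$, and symmetrically on the right. A homotopy monoid in $\mathbf{Top}$ is a colax monoidal functor $(X,\xi):(\Delta,+,0)\to(\mathbf{Top},\times,1)$ for which $\xi_0:X(0)\to 1$ and all $\xi_{m,n}:X(m+n)\to X(m)\times X(n)$ ($m,n\ge 0$) are homotopy equivalences. The object $X(1)$ is regarded as the underlying space of the homotopy monoid $(X,\xi)$; accordingly, saying that $\mathbf{Top}_*(S^1,B)$ is a homotopy monoid in $\mathbf{Top}$ is interpreted as saying that there is a homotopy monoid $(X,\xi)$ in $\mathbf{Top}$ with $X(1)=\mathbf{Top}_*(S^1,B)$. *)

(* Defs.v *)
From HB Require Import structures.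
From mathcomp Require Import all_boot all_order all_algebra.
From mathcomp Require Import all_classical all_reals all_analysis.
Set Implicit Arguments.
Unset Strict Implicit.
Unset Printing Implicit Defensive.
Import Order.TTheory GRing.Theory Num.Theory.
Import numFieldNormedType.Exports.
Local Open Scope classical_set_scope.

Record category := Category {
  obj :> Type;
  mor : obj -> obj -> Type;
  idm : forall A, mor A A;
  compm : forall A B D, mor B D -> mor A B -> mor A D;
  compm_idl : forall A B (f : mor A B), compm (idm B) f = f;
  compm_idr : forall A B (f : mor A B), compm f (idm A) = f;
  compmA : forall A B D E (f : mor D E) (g : mor B D) (h : mor A B),
    compm f (compm g h) = compm (compm f g) h
}.
Arguments mor {c} A B.
Arguments idm {c} A.
Arguments compm {c A B D} f g.

Notation "f \oc g" := (compm f g) (at level 50, left associativity).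

Definition is_iso (C : category) (A B : C) (f : mor A B) : Prop :=
  exists g : mor B A, g \oc f = idm A /\ f \oc g = idm B.

Definition eq_mor (C : category) (A B : C) (e : A = B) : mor A B :=
  match e in _ = B' return mor A B' with erefl => idm A end.

Record functor (C D : category) := Functor {
  fobj :> C -> D;
  fmap : forall A B : C, mor A B -> mor (fobj A) (fobj B);
  fmap_id : forall A : C, fmap (idm A) = idm (fobj A);
  fmap_comp : forall (A B E : C) (f : mor B E) (g : mor A B),
    fmap (f \oc g) = fmap f \oc fmap g
}.
Arguments fmap {C D} f0 {A B} f.

Record monoidal_category := MonoidalCategory {
  mcat :> category;
  tens : mcat -> mcat -> mcat;
  tensm : forall A A' B B' : mcat,
    mor A A' -> mor B B' -> mor (tens A B) (tens A' B');
  munit : mcat;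
  massoc : forall A B D : mcat, mor (tens (tens A B) D) (tens A (tens B D));
  mlunit : forall A : mcat, mor (tens munit A) A;
  mrunit : forall A : mcat, mor (tens A munit) A;
  tensm_id : forall A B : mcat, tensm (idm A) (idm B) = idm (tens A B);
  tensm_comp : forall (A A' A'' B B' B'' : mcat)
      (f' : mor A' A'') (f : mor A A') (g' : mor B' B'') (g : mor B B'),
    tensm (f' \oc f) (g' \oc g) = tensm f' g' \oc tensm f g;
  massoc_iso : forall A B D : mcat, is_iso (massoc A B D);
  mlunit_iso : forall A : mcat, is_iso (mlunit A);
  mrunit_iso : forall A : mcat, is_iso (mrunit A);
  massoc_nat : forall (A A' B B' D D' : mcat)
      (f : mor A A') (g : mor B B') (h : mor D D'),
    massoc A' B' D' \oc tensm (tensm f g) h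
    = tensm f (tensm g h) \oc massoc A B D;
  mlunit_nat : forall (A A' : mcat) (f : mor A A'),
    mlunit A' \oc tensm (idm munit) f = f \oc mlunit A;
  mrunit_nat : forall (A A' : mcat) (f : mor A A'),
    mrunit A' \oc tensm f (idm munit) = f \oc mrunit A;
  pentagon : forall A B D E : mcat,
    massoc A B (tens D E) \oc massoc (tens A B) D E
    = tensm (idm A) (massoc B D E) \oc massoc A (tens B D) E
      \oc tensm (massoc A B D) (idm E);
  triangle : forall A B : mcat,
    tensm (idm A) (mlunit B) \oc massoc A munit B
    = tensm (mrunit A) (idm B)
}.
Arguments tens {m} A B.
Arguments tensm {m A A' B B'} f g.
Arguments munit {m}.
Arguments massoc {m} A B D.
Arguments mlunit {m} A.
Arguments mrunit {m} A.

Notation "A \ox B" := (tens A B) (at level 40, left associativity).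
Notation "f \om g" := (tensm f g) (at level 40, left associativity).

Record colax_functor (M N : monoidal_category) := ColaxFunctor {
  colax_fun :> functor M N;
  cxi : forall A B : M,
    mor (colax_fun (A \ox B)) (colax_fun A \ox colax_fun B);
  cxi0 : mor (colax_fun munit) munit;
  cxi_nat : forall (A A' B B' : M) (f : mor A A') (g : mor B B'),
    cxi A' B' \oc fmap colax_fun (f \om g)
    = (fmap colax_fun f \om fmap colax_fun g) \oc cxi A B;
  cxi_coassoc : forall A B D : M,
    massoc (colax_fun A) (colax_fun B) (colax_fun D)
      \oc (cxi A B \om idm (colax_fun D)) \oc cxi (A \ox B) D
    = (idm (colax_fun A) \om cxi B D) \oc cxi A (B \ox D)
      \oc fmap colax_fun (massoc A B D);
  cxi_counitl : forall A : M,
    mlunit (colax_fun A) \oc (cxi0 \om idm (colax_fun A)) \oc cxi munit A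
    = fmap colax_fun (mlunit A);
  cxi_counitr : forall A : M,
    mrunit (colax_fun A) \oc (idm (colax_fun A) \om cxi0) \oc cxi A munit
    = fmap colax_fun (mrunit A)
}.
Arguments cxi {M N} c A B.
Arguments cxi0 {M N} c.

Record monoidal_transformation (M N : monoidal_category)
    (F G : colax_functor M N) := MonoidalTransformation {
  mtrans :> forall A : M, mor (F A) (G A);
  mtrans_nat : forall (A B : M) (f : mor A B),
    mtrans B \oc fmap F f = fmap G f \oc mtrans A;
  mtrans_cxi : forall A B : M,
    cxi G A B \oc mtrans (A \ox B) = (mtrans A \om mtrans B) \oc cxi F A B;
  mtrans_cxi0 : cxi0 G \oc mtrans munit = cxi0 F
}.

Section delta.

Lemma omorphP (m n : nat) (f g : {omorphism 'I_m -> 'I_n}) : f =1 g -> f = g.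
Proof.
case: f g => [f [[fP]]] [g [[gP]]] /= /funext fg; subst g.
by rewrite (Prop_irrelevance fP gP).
Qed.

Definition mk_omorph (m n : nat) (f : 'I_m -> 'I_n)
    (fP : {homo f : x y / (x <= y)%O}) : {omorphism 'I_m -> 'I_n} :=
  HB.pack f (Order.isOrderMorphism.Build _ _ _ _ f fP).

Definition delta_category : category.
Proof.
refine (@Category nat (fun m n => {omorphism 'I_m -> 'I_n})
  (fun m => [the {omorphism 'I_m -> 'I_m} of idfun])
  (fun m n p f g => [the {omorphism 'I_m -> 'I_p} of f \o g]) _ _ _);
  by move=> *; apply: omorphP.
Defined.

Definition sum_fun (m m' n n' : nat) (f : 'I_m -> 'I_m') (g : 'I_n -> 'I_n')
    (i : 'I_(m + n)) : 'I_(m' + n') :=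
  match fintype.split i with
  | inl j => lshift n' (f j)
  | inr k => rshift m' (g k)
  end.

Lemma sum_fun_homo (m m' n n' : nat) (f : {omorphism 'I_m -> 'I_m'})
    (g : {omorphism 'I_n -> 'I_n'}) :
  {homo sum_fun f g : x y / (x <= y)%O}.
Proof.
move=> x y; rewrite /sum_fun.
case: splitP => j xj; case: splitP => k yk; rewrite !leEord /= xj yk => xy.
- by have := @omorph_le _ _ _ _ f j k; rewrite !leEord; apply.
- by rewrite (leq_trans (ltnW (ltn_ord _)))// leq_addr.
- by have := leq_ltn_trans xy (ltn_ord k); rewrite ltnNge leq_addr.
- rewrite leq_add2l; have := @omorph_le _ _ _ _ g j k; rewrite !leEord; apply.
  by rewrite leq_add2l in xy.
Qed.

Definition sum_omorph (m m' n n' : nat) (f : {omorphism 'I_m -> 'I_m'})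
    (g : {omorphism 'I_n -> 'I_n'}) : {omorphism 'I_(m + n) -> 'I_(m' + n')} :=
  mk_omorph (@sum_fun_homo _ _ _ _ f g).

Lemma cast_ord_homo (m n : nat) (e : m = n) :
  {homo cast_ord e : x y / (x <= y)%O}.
Proof. by []. Qed.

Definition cast_omorph (m n : nat) (e : m = n) : {omorphism 'I_m -> 'I_n} :=
  mk_omorph (@cast_ord_homo _ _ e).

Lemma sum_funl m m' n n' (f : 'I_m -> 'I_m') (g : 'I_n -> 'I_n') j :
  sum_fun f g (lshift n j) = lshift n' (f j).
Proof. by rewrite /sum_fun (unsplitK (inl j)). Qed.

Lemma sum_funr m m' n n' (f : 'I_m -> 'I_m') (g : 'I_n -> 'I_n') k :
  sum_fun f g (rshift m k) = rshift m' (g k).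
Proof. by rewrite /sum_fun (unsplitK (inr k)). Qed.

Lemma ord_split m n (P : 'I_(m + n) -> Prop) :
  (forall j, P (lshift n j)) -> (forall k, P (rshift m k)) -> forall i, P i.
Proof. by move=> Pl Pr i; rewrite -(splitK i); case: (fintype.split i). Qed.

Lemma cast_omorph_iso (m n : nat) (e : m = n) :
  @is_iso delta_category m n (cast_omorph e).
Proof.
exists (cast_omorph (esym e)).
by split; apply: omorphP => i; apply: val_inj.
Qed.

Lemma cast_lshiftA (m n p : nat) (e : (m + n + p = m + (n + p))%N) (j : 'I_m) :
  cast_ord e (lshift p (lshift n j)) = lshift (n + p) j.
Proof. exact: val_inj. Qed.

Lemma cast_mshiftA (m n p : nat) (e : (m + n + p = m + (n + p))%N) (j : 'I_n) :
  cast_ord e (lshift p (rshift m j)) = rshift m (lshift p j).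
Proof. exact: val_inj. Qed.

Lemma cast_rshiftA (m n p : nat) (e : (m + n + p = m + (n + p))%N) (j : 'I_p) :
  cast_ord e (rshift (m + n) j) = rshift m (rshift n j).
Proof. by apply: val_inj; rewrite /= addnA. Qed.

Definition shiftA := (cast_lshiftA, cast_mshiftA, cast_rshiftA).

Definition Delta : monoidal_category.
Proof.
refine (@MonoidalCategory delta_category addn (@sum_omorph) 0%N
  (fun m n p => cast_omorph (esym (addnA m n p)))
  (fun m => cast_omorph (add0n m)) (fun m => cast_omorph (addn0 m))
  _ _ _ _ _ _ _ _ _ _).
- move=> m n; apply: omorphP.
  by apply: ord_split => i /=; rewrite ?sum_funl ?sum_funr.
- move=> m m' m'' n n' n'' f' f g' g; apply: omorphP.
  by apply: ord_split => i /=; rewrite ?(sum_funl, sum_funr).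
- by move=> *; exact: cast_omorph_iso.
- by move=> *; exact: cast_omorph_iso.
- by move=> *; exact: cast_omorph_iso.
- move=> m m' n n' p p' f g h; apply: omorphP.
  by apply: ord_split; first apply: ord_split; move=> i;
    rewrite /= ?(shiftA, sum_funl, sum_funr).
- move=> m m' f; apply: omorphP.
  apply: ord_split => [[]//|] i; rewrite /= sum_funr.
  apply: val_inj; rewrite /= add0n; congr (val (f _)); exact: val_inj.
- move=> m m' f; apply: omorphP.
  apply: ord_split => [i|[]//]; rewrite /= sum_funl.
  by apply: val_inj; rewrite /=; congr (val (f _)); exact: val_inj.
- move=> m n p q; apply: omorphP.
  by apply: ord_split; [apply: ord_split; [apply: ord_split|]|]; move=> i;
    rewrite /= ?(shiftA, sum_funl, sum_funr).
- move=> m n; apply: omorphP.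
  apply: ord_split; [apply: ord_split; last by case|]; move=> i;
    rewrite /= ?(shiftA, sum_funl, sum_funr) //.
  + by apply: val_inj.
  + exact: val_inj.
Defined.

End delta.

Definition compactly_generated (T : topologicalType) : Prop :=
  forall A : set T,
    (forall K : set T, compact K -> closed K -> closed (A `&` K)) -> closed A.

Record space := Space {
  space_top :> topologicalType;
  space_hausdorff : hausdorff_space space_top;
  space_cg : compactly_generated space_top
}.

(* The closed sets of [kify T] are the sets whose intersection with every
   closed compact set of [T] is closed in [T]. *)
Definition kify (T : Type) : Type := T.

Section kification.
Variable T : topologicalType.

Definition kopen (U : set T) : Prop :=
  forall K : set T, compact K -> closed K -> closed (~` U `&` K).

Lemma kopenT : kopen setT.
Proof. by move=> K _ _; rewrite setCT set0I; exact: closed0. Qed.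

Lemma kopenI : setI_closed kopen.
Proof.
move=> U V kU kV K cK clK; rewrite setCI setIUl.
by apply: closedU; [exact: kU|exact: kV].
Qed.

Lemma kopen_bigU (I : Type) (f : I -> set T) :
  (forall i, kopen (f i)) -> kopen (\bigcup_i f i).
Proof.
move=> kf K cK clK.
have -> : ~` (\bigcup_i f i) `&` K = K `&` \bigcap_i (~` f i `&` K).
  rewrite setC_bigcup eqEsubset; split => x.
    by move=> [fx Kx]; split => // i _; split => //; exact: fx.
  by move=> [Kx fx]; split => // i _; case: (fx i Logic.I).
by apply: closedI => //; apply: closed_bigI => i _; exact: kf.
Qed.

HB.instance Definition _ := Choice.on (kify T).
HB.instance Definition _ :=
  isOpenTopological.Build (kify T) kopenT kopenI kopen_bigU.

Lemma kclosedE (A : set T) : closed (A : set (kify T)) <->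
  (forall K : set T, compact K -> closed K -> closed (A `&` K)).
Proof. by rewrite -openC -[X in X <-> _]/(kopen (~` A)) /kopen setCK. Qed.

Lemma kify_closed (A : set T) : closed A -> closed (A : set (kify T)).
Proof. by move=> cA; apply/kclosedE => K _ clK; exact: closedI. Qed.

Lemma kify_open (A : set T) : open A -> open (A : set (kify T)).
Proof. by move=> oA; rewrite -closedC; apply: kify_closed; rewrite closedC. Qed.

Lemma kify_continuous : continuous (idfun : kify T -> T).
Proof. by apply/continuousP => A; exact: kify_open. Qed.

Lemma kify_compact (K : set T) :
  compact K -> closed K -> compact (K : set (kify T)).
Proof.
move=> cK clK F FF FK; have [p [Kp clFp]] := cK F FF FK.
exists p; split => // B V FB; rewrite nbhsE => -[U [oU Up UV]].
have clKU : closed (~` (U : set T) `&` K) by exact: oU.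
have : nbhs p (~` (~` (U : set T) `&` K)).
  by apply: open_nbhs_nbhs; split; [rewrite openC|case].
move/(clFp _ _ (filterI FB FK)) => [x [[Bx Kx] nUKx]].
exists x; split => //; apply: UV; apply: contrapT => nUx; exact: nUKx.
Qed.

Lemma kify_cg : compactly_generated (kify T).
Proof.
move=> A AK; apply/kclosedE => K cK clK.
have := AK K (kify_compact cK clK) (kify_closed clK).
by move/kclosedE => /(_ K cK clK); rewrite -setIA setIid.
Qed.

Lemma kify_hausdorff : hausdorff_space T -> hausdorff_space (kify T).
Proof.
rewrite !open_hausdorff => hT x y /hT [[U V] xy [oU oV UV]].
by exists (U, V) => //; split => //; exact: kify_open.
Qed.

Definition kspace (hT : hausdorff_space T) : space :=
  Space (kify_hausdorff hT) kify_cg.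

End kification.

Lemma kify_factor (X : space) (Y : topologicalType) (f : X -> Y) :
  hausdorff_space Y -> continuous f -> continuous (f : X -> kify Y).
Proof.
move=> hY cf; apply/continuous_closedP => A /kclosedE clA.
apply: space_cg => K cK clK.
have cfK : compact (f @` K).
  by apply: continuous_compact => //; exact: continuous_subspaceT.
have -> : f @^-1` A `&` K = f @^-1` (A `&` (f @` K)) `&` K.
  rewrite eqEsubset; split => x [].
    by move=> Afx Kx; split => //; split => //; exists x.
  by move=> [Afx _] Kx.
apply: closedI => //; apply: (continuous_closedP f).1 => //.
by apply: clA => //; exact: compact_closed.
Qed.

Lemma initial_hausdorff (S : choiceType) (T : topologicalType) (f : S -> T) :
  injective f -> hausdorff_space T -> hausdorff_space (initial_topology f).
Proof.
move=> injf; rewrite !open_hausdorff => hT x y xy.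
have /hT [[U V] [/= xU yV] [/= oU oV /eqP UV]] : f x != f y.
  by apply: contra xy => /eqP /injf ->.
rewrite !inE in xU yV.
exists (f @^-1` U, f @^-1` V); first by rewrite !inE.
split => /=; [by exists U|by exists V|].
by rewrite -preimage_setI UV preimage_set0.
Qed.

Lemma compact_cg (T : topologicalType) :
  compact [set: T] -> compactly_generated T.
Proof. by move=> cT A /(_ _ cT closedT); rewrite setIT. Qed.

Lemma set_type_compact (T : topologicalType) (A : set T) :
  compact A -> compact [set: A].
Proof.
move=> cA F FF _.
have FA : (set_val @ F) A.
  apply: (@filterS _ F _ setT); last exact: filterT.
  by move=> x _; exact: set_valP.
have [p [Ap clp]] := cA _ (fmap_proper_filter _ FF) FA.
exists (SigSub (mem_set Ap)); split => // B V FB [_ [[W oW <-] Wp WV]].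
have FB' : (set_val @ F) (set_val @` B).
  by apply: (@filterS _ F _ B) => // x Bx; exists x.
have [_ [[x Bx <-] Wx]] := clp _ _ FB' (open_nbhs_nbhs (conj oW Wp)).
by exists x; split => //; exact: WV.
Qed.

Definition compact_subspace (T : topologicalType) (A : set T)
    (hT : hausdorff_space T) (cA : compact A) : space :=
  @Space A (initial_hausdorff val_inj hT) (compact_cg (set_type_compact cA)).

Lemma prod_hausdorff (X Y : topologicalType) :
  hausdorff_space X -> hausdorff_space Y -> hausdorff_space (X * Y)%type.
Proof.
move=> hX hY [x y] [x' y'] clxy; congr (_, _).
- apply: hX => A B Ax Bx'.
  have /clxy : nbhs (x, y) (A `*` setT).
    by exists (A, setT) => //; split => //=; apply: filterT.
  have Bxy : nbhs (x', y') (B `*` setT).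
    by exists (B, setT) => //; split => //=; apply: filterT.
  by move/(_ _ Bxy) => [[u v] [[Au _] [Bu _]]]; exists u.
- apply: hY => A B Ay By'.
  have /clxy : nbhs (x, y) (setT `*` A).
    by exists (setT, A) => //; split => //=; apply: filterT.
  have Bxy : nbhs (x', y') (setT `*` B).
    by exists (setT, B) => //; split => //=; apply: filterT.
  by move/(_ _ Bxy) => [[u v] [[_ Av] [_ Bv]]]; exists v.
Qed.

(* The product in the category of compactly generated Hausdorff spaces is the
   k-ification of the product topology. *)
Definition prod_space (X Y : space) : space :=
  kspace (prod_hausdorff (@space_hausdorff X) (@space_hausdorff Y)).

Lemma point_compact : compact [set: discrete_topology unit].
Proof. by apply: finite_compact; exact: (@finite_finset unit setT). Qed.

Definition point_space : space :=
  @Space (discrete_topology unit) discrete_hausdorff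
    (compact_cg point_compact).

Section top.

Lemma fst_space_continuous (X Y : space) :
  continuous (fst : prod_space X Y -> X).
Proof.
move=> x.
exact: (@continuous_comp (prod_space X Y) (X * Y)%type _ idfun fst x
  (@kify_continuous _ x) cvg_fst).
Qed.

Lemma snd_space_continuous (X Y : space) :
  continuous (snd : prod_space X Y -> Y).
Proof.
move=> x.
exact: (@continuous_comp (prod_space X Y) (X * Y)%type _ idfun snd x
  (@kify_continuous _ x) cvg_snd).
Qed.

Definition fst_space (X Y : space) : continuousType (prod_space X Y) X :=
  mkcts (@fst_space_continuous X Y).

Definition snd_space (X Y : space) : continuousType (prod_space X Y) Y :=
  mkcts (@snd_space_continuous X Y).

Lemma pair_space_continuous (Z X Y : space)
    (f : continuousType Z X) (g : continuousType Z Y) :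
  continuous ((fun z => (f z, g z)) : Z -> prod_space X Y).
Proof.
apply: kify_factor.
  by apply: prod_hausdorff; exact: space_hausdorff.
by move=> z; apply: cvg_pair; exact: cts_fun.
Qed.

Definition pair_space (Z X Y : space) (f : continuousType Z X)
    (g : continuousType Z Y) : continuousType Z (prod_space X Y) :=
  mkcts (@pair_space_continuous Z X Y f g).

Definition top_category : category.
Proof.
refine (@Category space (fun X Y => continuousType X Y)
  (fun X => [the continuousType X X of idfun])
  (fun X Y Z g f => [the continuousType X Z of g \o f]) _ _ _);
  by move=> *; apply/continuousEP.
Defined.

Definition prod_map (X X' Y Y' : space) (f : continuousType X X')
    (g : continuousType Y Y') :
    continuousType (prod_space X Y) (prod_space X' Y') :=
  pair_space [the continuousType _ _ of f \o fst_space X Y]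
             [the continuousType _ _ of g \o snd_space X Y].

Definition prod_assoc (X Y Z : space) :
    continuousType (prod_space (prod_space X Y) Z)
                   (prod_space X (prod_space Y Z)) :=
  pair_space
    [the continuousType _ _ of fst_space X Y \o fst_space (prod_space X Y) Z]
    (pair_space
      [the continuousType _ _ of snd_space X Y \o fst_space (prod_space X Y) Z]
      (snd_space (prod_space X Y) Z)).

Definition prod_assoc_inv (X Y Z : space) :
    continuousType (prod_space X (prod_space Y Z))
                   (prod_space (prod_space X Y) Z) :=
  pair_space
    (pair_space (fst_space X (prod_space Y Z))
      [the continuousType _ _ of fst_space Y Z \o snd_space X (prod_space Y Z)])
    [the continuousType _ _ of snd_space Y Z \o snd_space X (prod_space Y Z)].

Definition const_space (X Y : space) (y : Y) : continuousType X Y :=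
  [the continuousType X Y of cst y].

Definition Top : monoidal_category.
Proof.
refine (@MonoidalCategory top_category prod_space prod_map point_space
  prod_assoc (snd_space point_space) (fun X => fst_space X point_space)
  _ _ _ _ _ _ _ _ _ _).
- by move=> X Y; apply/continuousEP => -[].
- by move=> X X' X'' Y Y' Y'' f' f g' g; apply/continuousEP => -[].
- move=> X Y Z; exists (prod_assoc_inv X Y Z).
  by split; apply/continuousEP; [case=> [[]]|case=> ? []].
- move=> X.
  exists (pair_space (const_space X (tt : point_space))
                     [the continuousType X X of idfun]).
  by split; apply/continuousEP; [case=> [[]]|].
- move=> X.
  exists (pair_space [the continuousType X X of idfun]
                     (const_space X (tt : point_space))).
  by split; apply/continuousEP; [case=> ? []|].
- by move=> X X' Y Y' Z Z' f g h; apply/continuousEP => -[[]].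
- by move=> X X' f; apply/continuousEP => -[].
- by move=> X X' f; apply/continuousEP => -[].
- by move=> X Y Z W; apply/continuousEP => -[[[]]].
- by move=> X Y; apply/continuousEP => -[[]].
Defined.

End top.

Section homotopy.
Variable R : realType.
Local Open Scope ring_scope.

Definition interval : space :=
  compact_subspace (@Rhausdorff R) (@segment_compact R 0 1).

Definition homotopic (X Y : space) (f g : continuousType X Y) : Prop :=
  exists h : continuousType (prod_space X interval) Y,
    forall (x : X) (t : interval),
      (set_val t = 0 -> h (x, t) = f x) /\ (set_val t = 1 -> h (x, t) = g x).

Definition homotopy_equivalence (X Y : space) (f : continuousType X Y) : Prop :=
  exists g : continuousType Y X,
    homotopic [the continuousType X X of g \o f]
              [the continuousType X X of idfun] /\
    homotopic [the continuousType Y Y of f \o g]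
              [the continuousType Y Y of idfun].

Definition is_homotopy_monoid (X : colax_functor Delta Top) : Prop :=
  homotopy_equivalence (cxi0 X) /\
  forall m n : nat, homotopy_equivalence (cxi X m n).

End homotopy.

Record based_space := BasedSpace {
  based_sp :> space;
  basept : based_sp
}.
Arguments basept : clear implicits.

Definition based_map (A B : based_space) : Type :=
  set_type [set f : continuousType A B | f (basept A) = basept B].

Section based.

Definition map_of (A B : based_space) (f : based_map A B) :
  continuousType A B := set_val f.

Lemma based_mapP (A B : based_space) (f : based_map A B) :
  map_of f (basept A) = basept B.
Proof. exact: set_valP f. Qed.

Definition mk_based (A B : based_space) (f : continuousType A B)
    (fP : f (basept A) = basept B) : based_map A B := SigSub (mem_set fP).

Definition based_id (A : based_space) : based_map A A :=
  @mk_based A A [the continuousType A A of idfun] erefl.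

Lemma based_comp_subproof (A B C : based_space) (g : based_map B C)
  (f : based_map A B) : map_of g (map_of f (basept A)) = basept C.
Proof. by rewrite !based_mapP. Qed.

Definition based_comp (A B C : based_space) (g : based_map B C)
    (f : based_map A B) : based_map A C :=
  @mk_based A C [the continuousType A C of map_of g \o map_of f]
    (based_comp_subproof g f).

(* Mapping spaces of compactly generated Hausdorff spaces carry the
   k-ification of the compact-open topology. *)
Definition to_compact_open (A B : based_space) (f : based_map A B) :
  {compact-open, A -> B} := (map_of f : A -> B).

Definition based_map_co (A B : based_space) : topologicalType :=
  initial_topology (@to_compact_open A B).

Lemma based_map_co_hausdorff (A B : based_space) :
  hausdorff_space (based_map_co A B).
Proof.
rewrite open_hausdorff => f g fg.
have [x fgx] : exists x, to_compact_open f x <> to_compact_open g x.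
  apply/existsNP => fgE; move/eqP: fg; apply; apply: val_inj.
  exact/continuousEP.
move: (@space_hausdorff B); rewrite open_hausdorff => hB.
have /hB [[U V] [/= xU yV] [/= oU oV /eqP UV]] :
  to_compact_open f x != to_compact_open g x by exact/eqP.
rewrite !inE in xU yV.
have cx := @compact_set1 A x.
pose ev (W : set B) : set {compact-open, A -> B} := [set h | h @` [set x] `<=` W].
have evE W (h : {compact-open, A -> B}) : ev W h <-> W (h x).
  by rewrite /ev /= image_set1 sub1set inE.
exists (@to_compact_open A B @^-1` ev U, @to_compact_open A B @^-1` ev V).
  by rewrite !inE; split => /=; apply/evE.
split => /=.
- by exists (ev U) => //; exact: compact_open_open.
- by exists (ev V) => //; exact: compact_open_open.
- apply/eqP; rewrite -subset0 => h [/evE Uh /evE Vh].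
  by have : (U `&` V) (to_compact_open h x) by []; rewrite UV.
Qed.

Definition based_map_space (A B : based_space) : space :=
  kspace (@based_map_co_hausdorff A B).

Lemma postcomp_continuous (A B C : based_space) (g : based_map B C) :
  continuous
    (based_comp g : based_map_space A B -> based_map_space A C).
Proof.
apply: kify_factor; first exact: based_map_co_hausdorff.
suff cg : continuous (based_comp g : based_map_co A B -> based_map_co A C).
  move=> f.
  exact: (@continuous_comp (based_map_space A B) (based_map_co A B)
    (based_map_co A C) idfun (based_comp g) f (@kify_continuous _ f) (cg f)).
apply: continuous_comp_initial => f.
apply/compact_open_cvgP; first by apply: fmap_filter; exact: (@nbhs_filter (based_map_co A B)).
move=> K O cK oO fKO.
have oW : open ((map_of g) @^-1` O).
  by apply: open_comp => // x _; exact: cts_fun.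
have fW : to_compact_open f @` K `<=` (map_of g) @^-1` O.
  by move=> _ [x Kx <-]; apply: fKO; exists x.
have : nbhs (f : based_map_co A B) (@to_compact_open A B @^-1`
    [set h | h @` K `<=` (map_of g) @^-1` O]).
  apply: open_nbhs_nbhs; split => //.
  by eexists; [exact: (compact_open_open cK oW)|].
apply: filterS => h hW _ [x Kx <-]; apply: (hW (to_compact_open h x)).
by exists x.
Qed.

Definition postcomp (A B C : based_space) (g : based_map B C) :
    continuousType (based_map_space A B) (based_map_space A C) :=
  mkcts (@postcomp_continuous A B C g).

End based.

Section loops.
Variable R : realType.
Local Open Scope ring_scope.

Definition unit_circle : set (R * R) := [set z | z.1 ^+ 2 + z.2 ^+ 2 = 1].

Lemma unit_circle_compact : compact unit_circle.
Proof.
apply: (@subclosed_compact _ _ ((`[-1, 1] : set R) `*` (`[-1, 1] : set R))).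
- have cf : continuous (fun z : R * R => z.1 ^+ 2 + z.2 ^+ 2 : R).
    move=> z; apply: (@cvgD _ R^o).
      by apply: cvgM; exact: cvg_fst.
    by apply: cvgM; exact: cvg_snd.
  have c1 : closed [set (1 : R)].
    by apply: accessible_closed_set1; apply: hausdorff_accessible; exact: Rhausdorff.
  exact: ((continuous_closedP _).1 cf _ c1).
- by apply: compact_setX; exact: segment_compact.
- move=> [x y] /= xy1; split; rewrite /= in_itv /= -ler_norml.
    by rewrite -(@expr_le1 _ 2) // real_normK ?num_real // -xy1 lerDl sqr_ge0.
  by rewrite -(@expr_le1 _ 2) // real_normK ?num_real // -xy1 lerDr sqr_ge0.
Qed.

Definition circle_space : space :=
  compact_subspace (prod_hausdorff (@Rhausdorff R) (@Rhausdorff R))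
    unit_circle_compact.

Lemma circle_basept_subproof : unit_circle (1, 0).
Proof. by rewrite /unit_circle /= expr1n expr0n addr0. Qed.

Definition circle : based_space :=
  @BasedSpace circle_space (SigSub (mem_set circle_basept_subproof)).

Definition loop_space (B : based_space) : space := based_map_space circle B.

Definition loop_map (B C : based_space) (f : based_map B C) :
  continuousType (loop_space B) (loop_space C) := postcomp circle f.

End loops.

(* Main.v *)
From mathcomp Require Import all_boot all_order all_algebra.
From mathcomp Require Import all_classical all_reals all_analysis.
From mathcomp Require Import ring lra.
Require Import Defs.
Set Implicit Arguments.
Unset Strict Implicit.
Unset Printing Implicit Defensive.
Import Order.TTheory GRing.Theory Num.Theory.
Import numFieldNormedType.Exports.
Local Open Scope classical_set_scope.

(** Take [X n] to be the space of maps to [B] from the simplex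
    [{0 <= t_0 <= ... <= t_(n-1) <= 1}] sending all vertices to the base point.
    The quotient of the simplex by its vertices embeds in the torus
    [(S^1)^n], by collapsing the ends of [[0, 1]] in every coordinate; as
    a subspace of the torus it is contravariantly functorial in [n] by mere
    reindexing of coordinates, and [xi m n] restricts a map to the front face
    [(t, 1, ..., 1)] and the back face [(0, ..., 0, t)].  Moving the first [m]
    coordinates down and the last [n] ones up, each clamped to [[0, 1]], by
    [min (sum of the first m) (sum of 1 - t over the last n)] deforms the cell
    onto the union of these two faces, which is their wedge; hence [xi m n] is
    a homotopy equivalence. *)

(** * Continuity criteria for quotients, products and mapping spaces *)

Lemma compact_quotient_continuous (A Y Z : topologicalType) (q : A -> Y)
    (g : Y -> Z) :
  compact [set: A] -> hausdorff_space Y -> continuous q ->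
  (forall y, exists x, q x = y) -> continuous (g \o q) -> continuous g.
Proof.
move=> cA hY cq sq cgq; apply/continuous_closedP => F clF.
(* Since [q] is onto, this preimage is the image of a closed subset of a compact space, so it is
   compact, hence closed in the Hausdorff [Y]: [q] is a quotient map. *)
have -> : g @^-1` F = q @` ((g \o q) @^-1` F).
  rewrite eqEsubset; split => [y Fy|_ [x Fx <-]//].
  by have [x qx] := sq y; exists x => //=; rewrite qx.
apply: compact_closed => //; apply: continuous_compact.
  exact: continuous_subspaceT.
apply: (@subclosed_compact _ _ setT) => //.
exact: ((continuous_closedP _).1 cgq).
Qed.

Lemma prod_topology_continuous (I : Type) (S : I -> topologicalType)
    (T : topologicalType) (f : T -> prod_topology S) :
  (forall i, continuous (fun x => f x i)) -> continuous f.
Proof.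
move=> cf x; apply/cvg_sup => i; move: x.
by apply: continuous_comp_initial; exact: cf.
Qed.

Lemma based_map_ext (A B : based_space) (f g : based_map A B) :
  (forall x, map_of f x = map_of g x) -> f = g.
Proof. by move=> fg; apply: val_inj; exact/continuousEP. Qed.

Lemma subbasic_open (A B : based_space) (K : set A) (O : set B) :
  compact K -> open O ->
  open ([set f | map_of f @` K `<=` O] : set (based_map_space A B)).
Proof.
move=> cK oO; apply: kify_open.
exists [set h : {compact-open, A -> B} | h @` K `<=` O] => //.
exact: compact_open_open.
Qed.

(** As [T] is compactly generated, the k-ification of the target can be ignored, and for the
    compact-open topology subbasic sets suffice. *)
Lemma based_map_space_continuous (T : space) (A B : based_space)
    (F : T -> based_map A B) :
  (forall (K : set A) (O : set B), compact K -> open O ->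
    open [set t | map_of (F t) @` K `<=` O]) ->
  continuous (F : T -> based_map_space A B).
Proof.
move=> oF; apply: kify_factor; first exact: based_map_co_hausdorff.
apply: continuous_comp_initial => t.
apply/compact_open_cvgP.
move=> K O cK oO tKO.
by apply: open_nbhs_nbhs; split; first exact: (oF K O).
Qed.

Section precomposition.
Variables (A A' B : based_space) (phi : based_map A A').

Lemma precomp_continuous :
  continuous
    ((fun f => based_comp f phi) : based_map_space A' B -> based_map_space A B).
Proof.
apply: based_map_space_continuous => K O cK oO.
have cphiK : compact (map_of phi @` K).
  apply: continuous_compact => //.
  by apply: continuous_subspaceT; exact: cts_fun.
have := subbasic_open cphiK oO.
by under eq_set do rewrite image_comp.
Qed.

Definition precomp :
    continuousType (based_map_space A' B) (based_map_space A B) :=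
  mkcts precomp_continuous.

End precomposition.

(** * Homotopies and restriction to a wedge *)

Section homotopies.
Variable R : realType.
Local Open Scope ring_scope.

Lemma interval_bounds (s : interval R) : 0 <= (set_val s : R) <= 1.
Proof. by have := set_valP s; rewrite /= in_itv. Qed.

Lemma homotopic_refl (X Y : space) (f g : continuousType X Y) :
  f =1 g -> homotopic R f g.
Proof.
move=> fg.
exists [the continuousType (prod_space X (interval R)) Y of
         f \o fst_space X (interval R)].
by move=> x t; split=> _ //=; rewrite fg.
Qed.

Lemma section_pair_continuous (S T : topologicalType) (s : T) :
  continuous ((fun z => (z, s)) : S -> (S * T)%type).
Proof. by move=> z; apply: cvg_pair; [exact: cvg_id|exact: cvg_cst]. Qed.

(* [K] deformation retracts onto the wedge of [P] and [Q], embedded by [i] and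
   [j]; the homotopy inverse glues [f \o r] and [g \o r']. *)
Section wedge.
Variables (P Q K B : based_space).
Variables (i : based_map P K) (j : based_map Q K).
Variables (r : based_map K P) (r' : based_map K Q).
Variable H : K * interval R -> K.
Hypotheses (ri : forall x, map_of r (map_of i x) = x)
  (r'i : forall x, map_of r' (map_of i x) = basept Q)
  (rj : forall x, map_of r (map_of j x) = basept P)
  (r'j : forall x, map_of r' (map_of j x) = x)
  (rr' : forall z, map_of r z = basept P \/ map_of r' z = basept Q).
Hypotheses (cH : continuous H)
  (H1 : forall z s, set_val s = 1 -> H (z, s) = z)
  (H0r : forall z s, set_val s = 0 -> map_of r' z = basept Q ->
    H (z, s) = map_of i (map_of r z))
  (H0r' : forall z s, set_val s = 0 -> map_of r z = basept P ->
    H (z, s) = map_of j (map_of r' z))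
  (Hb : forall s, H (basept K, s) = basept K).

(** By [rr'] these two closed sets cover [K]; the homotopy inverse is pasted from a map on each. *)
Let D : set K := [set z | map_of r' z = basept Q].
Let D' : set K := [set z | map_of r z = basept P].

Let closed_fiber (S T : space) (f : continuousType S T) (y : T) :
  closed [set x | f x = y].
Proof.
apply: ((continuous_closedP f).1 (@cts_fun _ _ f) [set y]).
apply: accessible_closed_set1; apply: hausdorff_accessible.
exact: space_hausdorff.
Qed.

(** On the overlap of [D] and [D'] both branches give the base point of [B], so the order of the
    test is immaterial. *)
Let glue_fun (fg : prod_space (based_map_space P B) (based_map_space Q B))
    (z : K) : B :=
  if pselect (D z) then map_of fg.1 (map_of r z)
  else map_of fg.2 (map_of r' z).

Let glue_funD fg z : D z -> glue_fun fg z = map_of fg.1 (map_of r z).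
Proof. by rewrite /glue_fun; case: pselect. Qed.

Let glue_funD' fg z : D' z -> glue_fun fg z = map_of fg.2 (map_of r' z).
Proof.
rewrite /glue_fun; case: pselect => // Dz D'z.
by rewrite Dz D'z !based_mapP.
Qed.

Let DD' z : D z \/ D' z.
Proof. by case: (rr' z); [right|left]. Qed.

Let glue_continuous fg : continuous (glue_fun fg).
Proof.
have clD : closed D by exact: closed_fiber.
have clD' : closed D' by exact: closed_fiber.
have cP : continuous (map_of fg.1 \o map_of r) by exact: cts_fun.
have cQ : continuous (map_of fg.2 \o map_of r') by exact: cts_fun.
apply/continuous_closedP => F clF.
have -> : glue_fun fg @^-1` F =
    (D `&` (map_of fg.1 \o map_of r) @^-1` F) `|`
    (D' `&` (map_of fg.2 \o map_of r') @^-1` F).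
  rewrite eqEsubset; split => z /=.
    move=> Fz; case: (DD' z) => Dz; [left|right]; split=> //=.
      by rewrite -glue_funD.
    by rewrite -glue_funD'.
  by case=> -[Dz /= Fz]; [rewrite glue_funD|rewrite glue_funD'].
by apply: closedU; apply: closedI => //; exact: (continuous_closedP _).1.
Qed.

Let glue_basept fg : mkcts (@glue_continuous fg) (basept K) = basept B.
Proof.
rewrite -[LHS]/(glue_fun fg (basept K)) glue_funD; last exact: based_mapP.
by rewrite !based_mapP.
Qed.

Let glue fg : based_map K B := mk_based (glue_basept fg).

Let glueE fg z : map_of (glue fg) z = glue_fun fg z.
Proof. by []. Qed.

(** A compact [C] is the union of its compact parts in [D] and [D'], so sending [C] into [O] amounts
    to one subbasic condition on each factor. *)
Let glue_cts : continuous
  (glue : prod_space (based_map_space P B) (based_map_space Q B) ->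
          based_map_space K B).
Proof.
apply: based_map_space_continuous => C O cC oO.
have clD : closed D by exact: closed_fiber.
have clD' : closed D' by exact: closed_fiber.
have hK := @space_hausdorff K.
have cP : compact (map_of r @` (C `&` D)).
  apply: continuous_compact.
    by apply: continuous_subspaceT; exact: cts_fun.
  apply: (subclosed_compact _ cC) => //.
  by apply: closedI => //; exact: compact_closed.
have cQ : compact (map_of r' @` (C `&` D')).
  apply: continuous_compact.
    by apply: continuous_subspaceT; exact: cts_fun.
  apply: (subclosed_compact _ cC) => //.
  by apply: closedI => //; exact: compact_closed.
pose W : set (based_map_space P B) :=
  [set f | map_of f @` (map_of r @` (C `&` D)) `<=` O].
pose W' : set (based_map_space Q B) :=
  [set f | map_of f @` (map_of r' @` (C `&` D')) `<=` O].
have -> : [set fg | map_of (glue fg) @` C `<=` O] =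
    (fst_space _ _ @^-1` W) `&` (snd_space _ _ @^-1` W').
  rewrite eqEsubset; split => fg /=.
    move=> CO; split.
      move=> _ [_ [z [Cz Dz] <-] <-]; apply: CO; exists z => //.
      by rewrite glueE glue_funD.
    move=> _ [_ [z [Cz Dz] <-] <-]; apply: CO; exists z => //.
    by rewrite glueE glue_funD'.
  move=> [CP CQ] _ [z Cz <-]; rewrite glueE; case: (DD' z) => Dz.
    rewrite glue_funD //; apply: CP; exists (map_of r z) => //.
    by exists z.
  rewrite glue_funD' //; apply: CQ; exists (map_of r' z) => //.
  by exists z.
apply: openI.
  by apply: open_comp; [move=> x _; exact: cts_fun|exact: subbasic_open].
by apply: open_comp; [move=> x _; exact: cts_fun|exact: subbasic_open].
Qed.

Let slide_fun (fs : prod_space (based_map_space K B) (interval R))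
    (z : K) : B :=
  map_of fs.1 (H (z, fs.2)).

Let slide_continuous fs : continuous (slide_fun fs).
Proof.
move=> z; apply: (@continuous_comp _ _ _ (fun z => H (z, fs.2)) (map_of fs.1)).
  apply: (@continuous_comp _ _ _ (fun z => (z, fs.2)) H); last exact: cH.
  exact: section_pair_continuous.
exact: cts_fun.
Qed.

Let slide_basept fs : mkcts (@slide_continuous fs) (basept K) = basept B.
Proof. by rewrite -[LHS]/(map_of fs.1 (H (basept K, fs.2))) Hb based_mapP. Qed.

Let slide fs : based_map K B := mk_based (slide_basept fs).

(** By [kify_open] it is enough to find, around each point, a box for the ordinary product topology:
    a subbasic set of maps times a neighbourhood of the time. *)
Let slide_cts : continuous
  (slide : prod_space (based_map_space K B) (interval R) ->
           based_map_space K B).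
Proof.
apply: based_map_space_continuous => C O cC oO; apply: kify_open.
rewrite openE => -[f s] /= fsO.
have oU : open (map_of f @^-1` O).
  by apply: open_comp => // x _; exact: cts_fun.
(* Tube lemma: [C] is compact, so one neighbourhood of [s] serves all its points. *)
have HU : \forall t \near s, C `<=` (fun z => (map_of f @^-1` O) (H (z, t))).
  have := (compact_near_coveringP C).1 cC.
  move/(_ _ (nbhs s) (fun t z => (map_of f @^-1` O) (H (z, t)))
    (nbhs_filter s)).
  apply=> z Cz.
  have : nbhs (H (z, s)) (map_of f @^-1` O).
    by apply: open_nbhs_nbhs; split=> //; apply: fsO; exists z.
  move=> /(@cH (z, s)) [[U V] /= [Uz Vs] UV].
  by exists (U, V) => // -[x t] /= UVxt; exact: (UV (x, t)).
(* Regularity shrinks this neighbourhood to some [V] whose closure is still inside it; then [H] maps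
   [C] times that closure onto a compact set, which defines a subbasic neighbourhood of [f]. *)
have regI : {for s, @regular_space (interval R)}.
  apply: (@compact_regular _ s setT).
  - exact: space_hausdorff.
  - exact: (set_type_compact (@segment_compact R 0 1)).
  - exact: filterT.
have [V Vs VU] := regI _ HU.
have cV : compact (closure V).
  apply: (@subclosed_compact _ _ setT) => //.
    exact: closed_closure.
  exact: (set_type_compact (@segment_compact R 0 1)).
have cHCV : compact (H @` (C `*` closure V)).
  apply: continuous_compact; first exact: continuous_subspaceT.
  exact: compact_setX.
exists ([set g | map_of g @` (H @` (C `*` closure V)) `<=` O], V).
  split => //=; apply: open_nbhs_nbhs; split; first exact: subbasic_open.
  by move=> _ [_ [[z t] /= [Cz Vt] <-] <-]; exact: VU.
move=> [g t] /= [gO Vt] _ [z Cz <-].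
apply: gO; exists (H (z, t)) => //; exists (z, t) => //; split => //=.
exact: subset_closure.
Qed.

Lemma wedge_retract_homotopy_equivalence :
  homotopy_equivalence R (pair_space (precomp B i) (precomp B j)).
Proof.
exists (mkcts glue_cts); split; last first.
  (* Gluing and then restricting is the identity on the nose; only the other composite needs the
     homotopy [slide]. *)
  apply: homotopic_refl => -[f g] /=; congr pair; apply: based_map_ext => x.
    rewrite -[LHS]/(glue_fun (f, g) (map_of i x)) glue_funD; last exact: r'i.
    by rewrite /= ri.
  rewrite -[LHS]/(glue_fun (f, g) (map_of j x)) glue_funD'; last exact: rj.
  by rewrite /= r'j.
exists (mkcts slide_cts) => f s; split=> s01.
  apply: based_map_ext => z; rewrite -[LHS]/(map_of f (H (z, s))).
  rewrite -[RHS]/(glue_fun (precomp B i f, precomp B j f) z).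
  case: (DD' z) => Dz; first by rewrite glue_funD // H0r.
  by rewrite glue_funD' // H0r'.
by apply: based_map_ext => z; rewrite -[LHS]/(map_of f (H (z, s))) H1.
Qed.

End wedge.
End homotopies.

(** * Collapsing the ends of the unit interval *)

Section collapse.
Variable R : realType.
Local Open Scope ring_scope.
Implicit Types t u : R.

(* The line of direction [(2 t - 1, 1 - |2 t - 1|)] turns by half a revolution
   as [t] runs through [[0, 1]]; [collapse_pt t] is the unit vector at twice
   its angle. *)
Definition collapse_den t : R := (1 - `|2 * t - 1|) ^+ 2 + (2 * t - 1) ^+ 2.

Definition collapse_pt t : R * R :=
  (((2 * t - 1) ^+ 2 - (1 - `|2 * t - 1|) ^+ 2) / collapse_den t,
   2 * (1 - `|2 * t - 1|) * (2 * t - 1) / collapse_den t).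

Lemma collapse_den_gt0 t : 0 < collapse_den t.
Proof.
rewrite /collapse_den lt_neqAle addr_ge0 ?sqr_ge0 // andbT eq_sym.
rewrite paddr_eq0 ?sqr_ge0 // !sqrf_eq0.
by case: eqP => //= a0; apply/eqP => b0; move: a0; rewrite b0 normr0; lra.
Qed.

Lemma collapse_subproof t : @unit_circle R (collapse_pt t).
Proof.
rewrite /unit_circle /=.
have := gt_eqF (collapse_den_gt0 t); rewrite /collapse_den => /eqP d0.
by field; exact/eqP.
Qed.

Definition collapse t : circle R := SigSub (mem_set (collapse_subproof t)).

Lemma continuous_to_circle (T : topologicalType) (f : T -> circle R) :
  continuous (fun x => set_val (f x) : R * R) -> continuous f.
Proof. by move=> cf; apply: continuous_comp_initial. Qed.

Lemma collapse_continuous : continuous collapse.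
Proof.
apply: continuous_to_circle => t.
have cb : {for t, continuous (fun t : R => 2 * t - 1 : R)}.
  apply: (@cvgB _ R^o); last exact: cvg_cst.
  by apply: cvgM; [exact: cvg_cst|exact: cvg_id].
have ca : {for t, continuous (fun t : R => 1 - `|2 * t - 1| : R)}.
  apply: (@cvgB _ R^o); first exact: cvg_cst.
  exact: (cvg_norm (V := R^o) cb).
have ca2 : {for t, continuous (fun t : R => (1 - `|2 * t - 1|) ^+ 2 : R)}.
  exact: cvgM.
have cb2 : {for t, continuous (fun t : R => (2 * t - 1) ^+ 2 : R)}.
  exact: cvgM.
have cd : {for t, continuous (fun t : R => (collapse_den t)^-1 : R)}.
  apply: cvgV; first by rewrite gt_eqF // collapse_den_gt0.
  exact: (@cvgD _ R^o).
suff : (collapse_pt x).1 @[x --> t] --> (collapse_pt t).1 /\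
       (collapse_pt x).2 @[x --> t] --> (collapse_pt t).2.
  by case; exact: cvg_pair.
split; apply: cvgM => //.
  exact: (@cvgB _ R^o).
by apply: cvgM => //; apply: cvgM => //; exact: cvg_cst.
Qed.

Lemma circle_ext (z w : circle R) :
  (set_val z : R * R) = set_val w -> z = w.
Proof. exact: val_inj. Qed.

Lemma collapse01 t : t = 0 \/ t = 1 -> collapse t = basept (circle R).
Proof.
move=> t01; apply: circle_ext.
rewrite -[LHS]/(collapse_pt t) -[RHS]/((1, 0) : R * R).
rewrite /collapse_pt /collapse_den.
have -> : (2 * t - 1) ^+ 2 = 1 by case: t01 => ->; ring.
have -> : `|2 * t - 1| = 1.
  case: t01 => ->; first by rewrite mulr0 sub0r normrN normr1.
  by rewrite ger0_norm; lra.
by rewrite subrr expr0n /= mulr0 mul0r subr0 add0r divr1 mul0r.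
Qed.

Lemma collapse_param_bound t : 0 <= t <= 1 -> 0 <= 1 - `|2 * t - 1|.
Proof. by move=> ?; rewrite subr_ge0 ler_norml; lra. Qed.

Lemma collapse_param_eq0 t : 1 - `|2 * t - 1| = 0 -> t = 0 \/ t = 1.
Proof. by case: (ger0P (2 * t - 1)) => _ ?; [right|left]; lra. Qed.

(* Off the base point, [y / (1 - x) = (2 t - 1) / (1 - |2 t - 1|)] recovers
   [t] from the point [(x, y)]. *)
Lemma collapse_inj t u : 0 <= t <= 1 -> 0 <= u <= 1 ->
  collapse t = collapse u ->
  t = u \/ ((t = 0 \/ t = 1) /\ (u = 0 \/ u = 1)).
Proof.
move=> t01 u01 /(congr1 (fun z => set_val z : R * R)).
rewrite -[LHS]/(collapse_pt t) -[RHS]/(collapse_pt u) => -[].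
have := collapse_den_gt0 t; have := collapse_den_gt0 u.
have := collapse_param_bound t01; have := collapse_param_bound u01.
have := @collapse_param_eq0 t; have := @collapse_param_eq0 u.
rewrite /collapse_den.
set a := 1 - `|2 * t - 1|; set a' := 1 - `|2 * u - 1|.
set b := 2 * t - 1; set b' := 2 * u - 1 => a'0 a0 a'_ge0 a_ge0 d' d.
move/eqP; rewrite eqr_div ?(gt_eqF d) ?(gt_eqF d') // => /eqP e1.
move/eqP; rewrite eqr_div ?(gt_eqF d) ?(gt_eqF d') // => /eqP e2.
have e1' : a ^+ 2 * b' ^+ 2 = a' ^+ 2 * b ^+ 2 by lra.
(* If one of [a], [a'] vanishes, [e1'] makes the other vanish too, so both parameters are ends of
   the interval. *)
have [a00|an0] := eqVneq a 0.
  right; split; first exact: a0.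
  apply: a'0; move: e1' d; rewrite a00 expr0n /= mul0r add0r => /esym/eqP.
  rewrite mulf_eq0 => /orP[|/eqP->]; last by rewrite ltxx.
  by rewrite sqrf_eq0 => /eqP.
have [a'00|a'n0] := eqVneq a' 0.
  right; split; last exact: a'0.
  apply: a0; move: e1' d'; rewrite a'00 expr0n /= mul0r add0r => /eqP.
  rewrite mulf_eq0 => /orP[|/eqP->]; last by rewrite ltxx.
  by rewrite sqrf_eq0 => /eqP.
left.
have a_gt0 : 0 < a by rewrite lt_neqAle eq_sym an0.
have a'_gt0 : 0 < a' by rewrite lt_neqAle eq_sym a'n0.
(* The first coordinates determine this equality only up to sign; the second ones, through [e2],
   settle the sign. *)
have e : a * b' = a' * b.
  have h : a' ^+ 2 * (a ^+ 2 + b ^+ 2) = a ^+ 2 * (a' ^+ 2 + b' ^+ 2) by lra.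
  have : (a * a' * (a ^+ 2 + b ^+ 2)) * (a * b' - a' * b) = 0.
    transitivity (a ^+ 2 * (a' * b' * (a ^+ 2 + b ^+ 2))
      - a * b * (a' ^+ 2 * (a ^+ 2 + b ^+ 2))); first by ring.
    have -> : a' * b' * (a ^+ 2 + b ^+ 2) = a * b * (a' ^+ 2 + b' ^+ 2) by lra.
    by rewrite h; ring.
  move/eqP; rewrite !mulf_eq0 (gt_eqF a_gt0) (gt_eqF a'_gt0) (gt_eqF d) /=.
  by rewrite subr_eq0 => /eqP.
suff : b = b' by rewrite /b /b'; lra.
move: e a_gt0 a'_gt0; rewrite /a /a' -/b -/b'.
by case: (ger0P b) => b0; case: (ger0P b') => b'0 e ? ?; nra.
Qed.

Lemma collapse_surj (z : circle R) : exists2 t, 0 <= t <= 1 & collapse t = z.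
Proof.
case: z => -[x y] xyP; have /= xy := set_mem xyP; rewrite /unit_circle /= in xy.
have [x1|xn1] := eqVneq x 1.
  exists 0; first by rewrite lexx ler01.
  rewrite collapse01; last by left.
  apply: circle_ext.
  rewrite -[LHS]/((1, 0) : R * R) -[RHS]/((x, y) : R * R) x1.
  congr pair; apply/esym/eqP.
  by rewrite -sqrf_eq0; apply/eqP; move: xy; rewrite x1; lra.
have x_lt1 : x < 1.
  rewrite lt_neqAle xn1; have [//|x1] := lerP x 1.
  have : 1 < x ^+ 2 by rewrite -(@expr1n R 2) ltr_pXn2r // nnegrE; lra.
  by have := sqr_ge0 y; lra.
(* Dividing [(1 - x, y)] by [D] normalizes it to a pair [(a, b)] with [a + |b| = 1], and [t] is then
   read off from [b = 2 t - 1]. *)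
pose D := 1 - x + `|y|.
have D0 : 0 < D by rewrite /D; have := normr_ge0 y; lra.
have yD : - D <= y <= D by rewrite -ler_norml /D; lra.
have tE : 2 * ((1 + y / D) / 2) - 1 = y / D by field; rewrite gt_eqF.
exists ((1 + y / D) / 2).
  have : -1 <= y / D <= 1 by rewrite ler_pdivlMr // ler_pdivrMr // mulN1r mul1r.
  lra.
apply: circle_ext.
rewrite -[LHS]/(collapse_pt _) -[RHS]/((x, y) : R * R).
rewrite /collapse_pt /collapse_den tE.
have Dn0 : D != 0 by rewrite gt_eqF.
have xn0 : 1 - x != 0 by rewrite gt_eqF // subr_gt0.
have -> : 1 - `|y / D| = (1 - x) / D.
  have yE : `|y| = D - (1 - x) by rewrite /D; ring.
  by rewrite normrM normfV (gtr0_norm D0) yE; field.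
have y2 : y ^+ 2 = (1 - x) * (1 + x) by lra.
have -> : ((1 - x) / D) ^+ 2 + (y / D) ^+ 2 = 2 * (1 - x) / D ^+ 2.
  by rewrite !expr_div_n y2; field.
by congr pair; rewrite ?expr_div_n ?y2; field; apply/andP.
Qed.

End collapse.

(** * Simplices with their vertices identified *)

Section cells.
Variable R : realType.
Local Open Scope ring_scope.

Definition simplex n : set (prod_topology (fun _ : 'I_n => R)) :=
  [set t | (forall i, 0 <= t i <= 1) /\
           (forall i j : 'I_n, (i <= j)%N -> t i <= t j)].

Lemma coord_continuous (n : nat) (S : 'I_n -> topologicalType) i :
  continuous (fun x : prod_topology S => x i).
Proof. exact: proj_continuous. Qed.

Lemma simplex_compact n : compact (@simplex n).
Proof.
apply: (@subclosed_compact _ _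
    [set t : prod_topology (fun _ : 'I_n => R) |
      forall i, `[0, 1]%classic (t i)]).
- rewrite (_ : @simplex n =
     \bigcap_(i in setT) [set t | `[0, 1]%classic (t i)] `&`
     \bigcap_(ij in [set ij : 'I_n * 'I_n | (ij.1 <= ij.2)%N])
        [set t | 0 <= t ij.2 - t ij.1]).
    apply: closedI; apply: closed_bigI => i _.
      apply: ((continuous_closedP _).1 _ _ (@itv_closed _ R 0 1)).
      exact: coord_continuous.
    pose d (t : prod_topology (fun _ : 'I_n => R)) : R := t i.2 - t i.1.
    have cd : continuous d.
      move=> t.
      apply: (@cvgB R R^o _ (nbhs t) _ (fun t => t i.2) (fun t => t i.1)).
        exact: (@coord_continuous n (fun=> R) i.2 t).
      exact: (@coord_continuous n (fun=> R) i.1 t).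
    exact: ((continuous_closedP d).1 cd _ (@closed_ge R 0)).
  rewrite eqEsubset; split => t /=.
    move=> [t01 tle]; split=> [i _|[i j] /= ij].
      by rewrite /= in_itv; exact: t01.
    by rewrite subr_ge0; exact: tle.
  move=> [t01 tle]; split=> [i|i j ij].
    by have := t01 i I; rewrite /= in_itv.
  by rewrite -subr_ge0; exact: (tle (i, j)).
- exact: (@tychonoff 'I_n (fun=> R) (fun=> `[0, 1]%classic)
    (fun=> @segment_compact R 0 1)).
- by move=> t [t01 _] i; rewrite /= in_itv; exact: t01.
Qed.

Definition liftable n (z : 'I_n -> circle R) : Prop :=
  exists2 t, @simplex n t & forall i, collapse (t i) = z i.

Lemma liftable_compact n :
  compact [set z : prod_topology (fun _ : 'I_n => circle R) | liftable z].
Proof.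
rewrite (_ : mkset _ = (fun t i => collapse (t i)) @` @simplex n).
  apply: continuous_compact; last exact: simplex_compact.
  apply: continuous_subspaceT; apply: prod_topology_continuous => i t.
  exact: (continuous_comp (@coord_continuous n (fun=> R) i t)
    (@collapse_continuous R _)).
rewrite eqEsubset; split => z /=.
  by move=> [t tn tz]; exists t => //; apply/funext.
by move=> [t tn <-]; exists t.
Qed.

Lemma simplex_cst n (c : R) : 0 <= c <= 1 -> @simplex n (fun=> c).
Proof. by move=> c01; split. Qed.

Lemma liftable_basept n : @liftable n (fun=> basept (circle R)).
Proof.
exists (fun=> 0); first by apply: simplex_cst; rewrite lexx ler01.
by move=> i; rewrite collapse01 //; left.
Qed.

Definition subtorus_space n : space :=
  compact_subspace
    (@hausdorff_product _ (fun _ : 'I_n => circle R)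
      (fun=> @space_hausdorff (circle R)))
    (@liftable_compact n).

Definition subtorus n : based_space :=
  @BasedSpace (subtorus_space n) (SigSub (mem_set (@liftable_basept n))).

(* [subtorus 1] is only isomorphic to the circle. *)
Definition cell n : based_space := if n is 1%N then circle R else subtorus n.

Definition coord n : cell n -> 'I_n -> circle R :=
  match n return cell n -> 'I_n -> circle R with
  | 0 => fun z => set_val (z : subtorus 0)
  | 1 => fun z _ => z
  | n'.+2 => fun z => set_val (z : subtorus n'.+2)
  end.

Lemma coord_inj n (z w : cell n) : (forall i, coord z i = coord w i) -> z = w.
Proof.
case: n z w => [|[|n]] z w zw; last by apply: val_inj; exact/funext.
  by apply: val_inj; exact/funext.
exact: (zw ord0).
Qed.

Lemma cell_mk_subproof n (z : 'I_n -> circle R) :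
  liftable z -> {x : cell n | forall i, coord x i = z i}.
Proof.
case: n z => [|[|n]] z lz.
- by exists (SigSub (mem_set lz) : subtorus 0).
- by exists (z ord0) => i; rewrite (ord1 i).
- by exists (SigSub (mem_set lz) : subtorus n.+2).
Qed.

Definition cell_mk n z (lz : @liftable n z) : cell n :=
  sval (cell_mk_subproof lz).

Lemma cell_mkE n z (lz : @liftable n z) i : coord (cell_mk lz) i = z i.
Proof. exact: (svalP (cell_mk_subproof lz)). Qed.

Lemma coord_liftable n (z : cell n) : liftable (coord z).
Proof.
case: n z => [|[|n]] z; [exact: (set_valP z)| |exact: (set_valP z)].
(* The 1-cell is the whole circle, so here liftability is the surjectivity of [collapse]. *)
by have [t t01 tz] := collapse_surj z; exists (fun=> t).
Qed.

Lemma coord_basept n i : coord (basept (cell n)) i = basept (circle R).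
Proof. by case: n i => [|[|n]] i. Qed.

Lemma cell_continuous n (T : topologicalType) (f : T -> cell n) :
  (forall i, continuous (fun x => coord (f x) i)) -> continuous f.
Proof.
case: n f => [|[|n]] f cf; last 1 first.
- apply: continuous_comp_initial; apply: prod_topology_continuous; exact: cf.
- apply: continuous_comp_initial; apply: prod_topology_continuous; exact: cf.
- exact: (cf ord0).
Qed.

Lemma cell_coord_continuous n i : continuous (fun z : cell n => coord z i).
Proof.
case: n i => [|[|n]] i.
- by case: i.
- by move=> z; exact: cvg_id.
- move=> z; apply: (@continuous_comp _ _ _ (fun z : subtorus n.+2 => set_val z)
    (fun x : prod_topology (fun _ => circle R) => x i)).
    exact: initial_continuous.
  exact: coord_continuous.
Qed.

(** [None] freezes a coordinate at an end of the interval. The ends [0] and [1] collapse to the same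
    point, so degeneracies, front faces and back faces all take this form. *)
Definition reindex n m (rho : 'I_m -> option 'I_n) (z : 'I_n -> circle R) :
  'I_m -> circle R :=
  fun k => if rho k is Some j then z j else basept (circle R).

Definition lifting n m (rho : 'I_m -> option 'I_n) : Prop :=
  forall z, liftable z -> liftable (reindex rho z).

Section cell_map.
Variables (n m : nat) (rho : 'I_m -> option 'I_n) (lrho : lifting rho).

Definition cell_map_fun (z : cell n) : cell m :=
  cell_mk (lrho (coord_liftable z)).

Lemma cell_map_fun_continuous : continuous cell_map_fun.
Proof.
apply: cell_continuous => i.
under eq_fun do rewrite cell_mkE /reindex.
case: (rho i) => [j|]; first exact: cell_coord_continuous.
by move=> z; exact: cvg_cst.
Qed.

Lemma cell_map_basept :
  mkcts cell_map_fun_continuous (basept (cell n)) = basept (cell m).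
Proof.
apply: coord_inj => i; rewrite /= cell_mkE /reindex coord_basept.
by case: (rho i) => // j; rewrite coord_basept.
Qed.

Definition cell_map : based_map (cell n) (cell m) := mk_based cell_map_basept.

Lemma coord_cell_map z i : coord (map_of cell_map z) i =
  if rho i is Some j then coord z j else basept (circle R).
Proof. exact: cell_mkE. Qed.

End cell_map.

Lemma lifting_omorph (n m : nat) (f : {omorphism 'I_m -> 'I_n}) :
  lifting (fun i => Some (f i)).
Proof.
move=> z [t [t01 tle] tz].
exists (fun i => t (f i)); last by move=> i; exact: tz.
split=> [i|i j ij]; first exact: t01.
by apply: tle; have := @omorph_le _ _ _ _ f i j; rewrite !leEord; apply.
Qed.

Definition front (m n : nat) (k : 'I_(m + n)) : option 'I_m :=
  if fintype.split k is inl j then Some j else None.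

Definition back (m n : nat) (k : 'I_(m + n)) : option 'I_n :=
  if fintype.split k is inr j then Some j else None.

Lemma front_lshift (m n : nat) (j : 'I_m) :
  front (lshift n j) = Some j :> option 'I_m.
Proof. by rewrite /front (unsplitK (inl j)). Qed.

Lemma front_rshift (m n : nat) (j : 'I_n) :
  front (rshift m j) = None :> option 'I_m.
Proof. by rewrite /front (@unsplitK m n (inr j)). Qed.

Lemma back_lshift (m n : nat) (j : 'I_m) :
  back (lshift n j) = None :> option 'I_n.
Proof. by rewrite /back (@unsplitK m n (inl j)). Qed.

Lemma back_rshift (m n : nat) (j : 'I_n) :
  back (rshift m j) = Some j :> option 'I_n.
Proof. by rewrite /back (@unsplitK m n (inr j)). Qed.

Definition splitE :=
  (front_lshift, front_rshift, back_lshift, back_rshift, sum_funl, sum_funr).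

Definition concat (m n : nat) (t : 'I_m -> R) (u : 'I_n -> R)
    (k : 'I_(m + n)) : R :=
  match fintype.split k with inl j => t j | inr j => u j end.

Lemma simplex_concat (m n : nat) (t : 'I_m -> R) (u : 'I_n -> R) :
  @simplex m t -> @simplex n u -> (forall i j, t i <= u j) ->
  @simplex (m + n) (concat t u).
Proof.
move=> [t01 tle] [u01 ule] tu; split=> [k|k l].
  by rewrite /concat; case: fintype.split.
rewrite /concat; case: splitP => i ->; case: splitP => j -> //=.
- exact: tle.
- by move=> ij; have := leq_ltn_trans ij (ltn_ord j); rewrite ltnNge leq_addr.
- by rewrite leq_add2l; exact: ule.
Qed.

Lemma lifting_front (m n : nat) : lifting (@front m n).
Proof.
move=> z [t ts tz]; have [t01 _] := ts.
exists (concat t (fun _ : 'I_n => 1)).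
  apply: simplex_concat => //; first by apply: simplex_cst; rewrite lexx ler01.
  by move=> i j; have /andP[] := t01 i.
rewrite /reindex /concat /front => k.
case: fintype.split => [j|j]; first exact: tz.
by rewrite collapse01 //; right.
Qed.

Lemma lifting_back (m n : nat) : lifting (@back m n).
Proof.
move=> z [t ts tz]; have [t01 _] := ts.
exists (concat (fun _ : 'I_m => 0) t).
  apply: simplex_concat => //; first by apply: simplex_cst; rewrite lexx ler01.
  by move=> i j; have /andP[] := t01 j.
rewrite /reindex /concat /back => k.
case: fintype.split => [j|j]; last exact: tz.
by rewrite collapse01 //; left.
Qed.

Definition degeneracy (m n : nat) (f : {omorphism 'I_m -> 'I_n}) :
  based_map (cell n) (cell m) := cell_map (lifting_omorph f).
Definition front_face (m n : nat) : based_map (cell m) (cell (m + n)) :=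
  cell_map (@lifting_front m n).
Definition back_face (m n : nat) : based_map (cell n) (cell (m + n)) :=
  cell_map (@lifting_back m n).

End cells.

(** * The colax monoidal functor of mapping spaces out of cells *)

Section loop_functor.
Variables (R : realType) (B : based_space).

Definition loop_obj n : space := based_map_space (cell R n) B.

Definition loop_functor : functor Delta Top.
Proof.
refine (@Functor Delta Top loop_obj
  (fun m n f => precomp B (degeneracy R f)) _ _).
- move=> n; apply/continuousEP => f; apply: based_map_ext => x.
  congr (map_of f _); apply: coord_inj => i.
  by rewrite coord_cell_map.
- move=> m n p f g; apply/continuousEP => h; apply: based_map_ext => x.
  congr (map_of h _); apply: coord_inj => i.
  by rewrite !coord_cell_map.
Defined.

(** Each axiom on [xi] compares precompositions with cell maps, so it reduces to an equality of
    reindexings, checked one coordinate at a time. *)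
Definition loop_colax : colax_functor Delta Top.
Proof.
refine (@ColaxFunctor Delta Top loop_functor
  (fun m n => pair_space (precomp B (front_face R m n))
                         (precomp B (back_face R m n)))
  (const_space (loop_obj 0) (tt : point_space)) _ _ _ _).
- move=> m m' n n' f g; apply/continuousEP => h.
  congr pair; apply: based_map_ext => x; congr (map_of h _);
    apply: coord_inj; apply: ord_split => i;
    by rewrite !coord_cell_map /= !splitE ?coord_cell_map.
- move=> m n p; apply/continuousEP => h.
  congr pair; last congr pair; apply: based_map_ext => x;
    congr (map_of h _); apply: coord_inj; apply: ord_split => [|i];
    try apply: ord_split => i;
    by rewrite !(coord_cell_map, shiftA, splitE) /=
               ?(coord_cell_map, shiftA, splitE).
- move=> n; apply/continuousEP => h; apply: based_map_ext => x.
  congr (map_of h _); apply: coord_inj; apply: ord_split => [[]//|i].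
  rewrite !coord_cell_map splitE; congr (coord x _); exact: val_inj.
- move=> n; apply/continuousEP => h; apply: based_map_ext => x.
  congr (map_of h _); apply: coord_inj; apply: ord_split => [i|[]//].
  rewrite !coord_cell_map splitE; congr (coord x _); exact: val_inj.
Defined.

End loop_functor.

(** * Naturality in the based space *)

Section naturality.
Variables (R : realType) (B C : based_space) (f : based_map B C).

(** Postcomposition with [f] commutes strictly with every precomposition, so all squares commute on
    the nose. *)
Definition loop_trans :
  monoidal_transformation (loop_colax R B) (loop_colax R C).
Proof.
refine (@MonoidalTransformation Delta Top (loop_colax R B) (loop_colax R C)
  (fun n => postcomp (cell R n) f) _ _ _).
- by move=> m n g; apply/continuousEP => h; exact: based_map_ext.
- move=> m n; apply/continuousEP => h; congr pair; exact: based_map_ext.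
- exact/continuousEP.
Defined.

End naturality.

(** * Deformation of a cell onto two of its faces *)

Section deformation.
Variables (R : realType) (m n : nat).
Local Open Scope ring_scope.
Implicit Types (t u : 'I_(m + n) -> R) (c : R).

(** Two properties matter: it vanishes on both faces, and it bounds either every entry of the first
    block or every [1 - t] of the second. *)
Definition gap t : R :=
  Num.min (\sum_(i < m) t (lshift n i)) (\sum_(j < n) (1 - t (rshift m j))).

Definition spread t c : 'I_(m + n) -> R :=
  concat (fun i => Num.max 0 (t (lshift n i) - c * gap t))
         (fun j => Num.min 1 (t (rshift m j) + c * gap t)).

Lemma spread_lshift t c i :
  spread t c (lshift n i) = Num.max 0 (t (lshift n i) - c * gap t).
Proof. by rewrite /spread /concat (unsplitK (inl i)). Qed.

Lemma spread_rshift t c j :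
  spread t c (rshift m j) = Num.min 1 (t (rshift m j) + c * gap t).
Proof. by rewrite /spread /concat (@unsplitK m n (inr j)). Qed.

Lemma gap_ge0 t : simplex t -> 0 <= gap t.
Proof.
move=> [t01 _]; rewrite /gap le_min !sumr_ge0 // => i _.
  by rewrite subr_ge0; case/andP: (t01 (rshift m i)).
by case/andP: (t01 (lshift n i)).
Qed.

(** The minimum is one of the two sums, and a sum of nonnegative terms bounds each of them. *)
Lemma gap_dominates t : simplex t ->
  (forall i, t (lshift n i) <= gap t) \/
  (forall j, 1 - t (rshift m j) <= gap t).
Proof.
move=> [t01 _]; rewrite /gap; case: leP => _; [left => i|right => j].
  rewrite (bigD1 i) //= lerDl sumr_ge0 // => k _.
  by case/andP: (t01 (lshift n k)).
rewrite (bigD1 j) //= lerDl sumr_ge0 // => k _.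
by rewrite subr_ge0; case/andP: (t01 (rshift m k)).
Qed.

Lemma gap_front0 t : simplex t -> (forall i, t (lshift n i) = 0) -> gap t = 0.
Proof.
move=> ts t0; apply/le_anti; rewrite gap_ge0 // andbT.
by rewrite /gap big1 ?ge_min ?lexx.
Qed.

Lemma gap_back1 t : simplex t -> (forall j, t (rshift m j) = 1) -> gap t = 0.
Proof.
move=> ts t1; apply/le_anti; rewrite gap_ge0 // andbT.
rewrite /gap [X in Num.min _ X]big1 ?ge_min ?lexx ?orbT // => j _.
by rewrite t1 subrr.
Qed.

Lemma simplex_shift t i j : simplex t -> t (lshift n i) <= t (rshift m j).
Proof.
by move=> [_]; apply; rewrite /= (leq_trans (ltnW (ltn_ord i))) // leq_addr.
Qed.

(** Either the first block is all [0], or it contains a [1] and monotonicity makes the second block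
    all [1]. *)
Lemma gap_front01 t : simplex t ->
  (forall i, t (lshift n i) = 0 \/ t (lshift n i) = 1) -> gap t = 0.
Proof.
move=> ts tf; have [t0|/existsNP [i ti]] :=
  pselect (forall i, t (lshift n i) = 0); first exact: gap_front0.
have {}ti : t (lshift n i) = 1 by case: (tf i).
apply: gap_back1 => // j; apply/le_anti.
by rewrite -{2}ti simplex_shift // andbT; case/andP: (ts.1 (rshift m j)).
Qed.

Lemma gap_back01 t : simplex t ->
  (forall j, t (rshift m j) = 0 \/ t (rshift m j) = 1) -> gap t = 0.
Proof.
move=> ts tb; have [t1|/existsNP [j tj]] :=
  pselect (forall j, t (rshift m j) = 1); first exact: gap_back1.
have {}tj : t (rshift m j) = 0 by case: (tb j).
apply: gap_front0 => // i; apply/le_anti.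
by rewrite -{1}tj simplex_shift //; case/andP: (ts.1 (lshift n i)).
Qed.

(** Each block is translated by a constant and clamped, which keeps its order, and the two blocks
    only move apart. *)
Lemma simplex_spread t c : simplex t -> 0 <= c -> simplex (spread t c).
Proof.
move=> ts c0; have [t01 tle] := ts.
have cg : 0 <= c * gap t by rewrite mulr_ge0 // gap_ge0.
apply: simplex_concat.
- split=> [i|i j ij].
    rewrite le_max lexx /= ge_max ler01 /=.
    by case/andP: (t01 (lshift n i)) => _ ?; lra.
  by rewrite ge_max !le_max lexx /= lerD2r tle ?orbT.
- split=> [j|i j ij].
    rewrite ge_min lexx /= andbT le_min ler01 /=.
    by case/andP: (t01 (rshift m j)) => ? _; lra.
  by rewrite le_min !ge_min lexx /= lerD2r tle ?orbT //= leq_add2l.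
- move=> i j; have := simplex_shift i j ts.
  have /andP[t0 _] := t01 (rshift m j); have /andP[_ t1] := t01 (lshift n i).
  by move=> ij; rewrite ge_max !le_min ler01 /=; apply/and3P; split; lra.
Qed.

Lemma spread_gap0 t c : simplex t -> c * gap t = 0 ->
  forall k, spread t c k = t k.
Proof.
move=> [t01 _] cg; apply: ord_split => i.
  by rewrite spread_lshift cg subr0 max_r //; case/andP: (t01 (lshift n i)).
by rewrite spread_rshift cg addr0 min_r //; case/andP: (t01 (rshift m i)).
Qed.

Lemma spread1 t : simplex t ->
  (forall i, spread t 1 (lshift n i) = 0) \/
  (forall j, spread t 1 (rshift m j) = 1).
Proof.
move=> ts; case: (gap_dominates ts) => tg; [left|right] => k.
  by rewrite spread_lshift mul1r max_l // subr_le0.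
by rewrite spread_rshift mul1r min_l //; have := tg k; lra.
Qed.

(* Two different monotone lifts of the same point have all their entries in
   [{0, 1}], where the deformation does nothing. *)
Lemma collapse_spread t u c : simplex t -> simplex u ->
  (forall k, collapse (t k) = collapse (u k)) ->
  forall k, collapse (spread t c k) = collapse (spread u c k).
Proof.
move=> ts us tu.
have [/funext -> //|/existsNP [k tuk]] := pselect (t =1 u).
have [t01 tle] := ts; have [u01 ule] := us.
have inj l := collapse_inj (t01 l) (u01 l) (tu l).
suff H : forall l, (t l = 0 \/ t l = 1) /\ (u l = 0 \/ u l = 1).
  move=> l; rewrite !spread_gap0 ?gap_front01 ?mulr0 //.
    by move=> i; case: (H (lshift n i)).
  by move=> i; case: (H (lshift n i)).
move=> l; case: (inj k) => // -[tk uk]; case: (inj l) => // tul.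
suff : t l = 0 \/ t l = 1 by rewrite -tul.
have /andP[t0 t1] := t01 l.
have : t k <= t l \/ t l <= t k.
  by case: (leqP k l) => kl; [left; exact: tle|right; apply: tle; exact: ltnW].
have : u k <= u l \/ u l <= u k.
  by case: (leqP k l) => kl; [left; exact: ule|right; apply: ule; exact: ltnW].
(* At [k] one lift is [0] and the other [1]. The common value at [l] is above both if [k <= l],
   hence [1], and below both if [l <= k], hence [0]. *)
case: (leqP k l) => [kl|/ltnW kl].
  have := tle _ _ kl; have := ule _ _ kl; rewrite -tul => ? ? _ _; right.
  by case: tk => tk; case: uk => uk; lra.
have := tle _ _ kl; have := ule _ _ kl; rewrite -tul => ? ? _ _; left.
by case: tk => tk; case: uk => uk; lra.
Qed.

(** An arbitrary choice, with no continuity claimed; [collapse_spread] makes the slide independent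
    of it. *)
Definition lift_of (z : cell R (m + n)) : 'I_(m + n) -> R :=
  s2val (cid2 (coord_liftable z)).

Lemma simplex_lift_of z : simplex (lift_of z).
Proof. exact: s2valP (cid2 (coord_liftable z)). Qed.

Lemma collapse_lift_of z k : collapse (lift_of z k) = coord z k.
Proof. exact: (s2valP' (cid2 (coord_liftable z))). Qed.

Lemma slide_subproof (zs : cell R (m + n) * interval R) :
  liftable (fun k => collapse (spread (lift_of zs.1) (1 - set_val zs.2) k)).
Proof.
exists (spread (lift_of zs.1) (1 - set_val zs.2)) => //.
apply: simplex_spread; first exact: simplex_lift_of.
by have := interval_bounds zs.2; lra.
Qed.

(** Time is reversed: the identity at [1] and the retraction onto the wedge at [0], as the direction
    of the homotopy requires. *)
Definition cell_slide (zs : cell R (m + n) * interval R) : cell R (m + n) :=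
  cell_mk (slide_subproof zs).

Lemma coord_cell_slide z s t : simplex t ->
  (forall k, collapse (t k) = coord z k) ->
  forall k, coord (cell_slide (z, s)) k = collapse (spread t (1 - set_val s) k).
Proof.
move=> ts tz k; rewrite cell_mkE; apply: collapse_spread => //.
  exact: simplex_lift_of.
by move=> l; rewrite collapse_lift_of tz.
Qed.

Lemma sum_real_continuous (T : topologicalType) (I : finType)
    (F : I -> T -> R) :
  (forall i, continuous (F i)) -> continuous (fun x => \sum_i F i x).
Proof.
by move=> cF; apply: (continuous_big (@add_continuous R)) => i _; exact: cF.
Qed.

Lemma gap_continuous (T : topologicalType) (t : T -> 'I_(m + n) -> R) :
  (forall k, continuous (fun x => t x k)) -> continuous (fun x => gap (t x)).
Proof.
move=> ct.
apply: (min_fun_continuous (T := R)); apply: sum_real_continuous => i.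
  exact: ct.
by move=> x; apply: (@cvgB R R^o); [exact: cvg_cst|exact: ct].
Qed.

Lemma spread_continuous (T : topologicalType) (t : T -> 'I_(m + n) -> R)
    (c : T -> R) :
  (forall k, continuous (fun x => t x k)) -> continuous c ->
  forall k, continuous (fun x => spread (t x) (c x) k).
Proof.
move=> ct cc; have cg := gap_continuous ct.
apply: ord_split => i.
  under eq_fun do rewrite spread_lshift.
  apply: (max_fun_continuous (T := R)) => x; first exact: cvg_cst.
  by apply: (@cvgB R R^o); [exact: ct|apply: cvgM; [exact: cc|exact: cg]].
under eq_fun do rewrite spread_rshift.
apply: (min_fun_continuous (T := R)) => x; first exact: cvg_cst.
by apply: (@cvgD R R^o); [exact: ct|apply: cvgM; [exact: cc|exact: cg]].
Qed.

(** Continuity is tested after pulling back along the quotient map [q] from simplex times interval,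
    where the tautological lift replaces the chosen one and the formula is explicit. *)
Lemma cell_slide_continuous : continuous cell_slide.
Proof.
pose A : topologicalType := (set_type (@simplex R (m + n)) * interval R)%type.
have lA (t : @simplex R (m + n)) : liftable (fun k => collapse (set_val t k)).
  by exists (set_val t) => //; exact: set_valP.
pose q (ts : A) :=
  (cell_mk (lA ts.1), ts.2).
have ct k : continuous (fun ts : A =>
    set_val ts.1 k : R).
  move=> ts; apply: (@continuous_comp _ _ _ (fun ts => set_val ts.1)
    (fun x : prod_topology (fun=> R) => x k)); last exact: coord_continuous.
  apply: (@continuous_comp _ _ _ fst set_val); first exact: cvg_fst.
  exact: initial_continuous.
have cs : continuous (fun ts : A =>
    1 - set_val ts.2 : R).
  move=> ts; apply: (@cvgB _ R^o); first exact: cvg_cst.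
  apply: (@continuous_comp _ _ _ snd set_val); first exact: cvg_snd.
  exact: initial_continuous.
apply: (@compact_quotient_continuous _ _ _ q).
- rewrite -setXTT; apply: compact_setX; apply: set_type_compact.
    exact: simplex_compact.
  exact: segment_compact.
- by apply: prod_hausdorff; exact: space_hausdorff.
- have cl : continuous (fun ts : A => cell_mk (lA ts.1)).
    apply: cell_continuous => k.
    under eq_fun do rewrite cell_mkE.
    by move=> ts; exact: (continuous_comp (ct k ts) (@collapse_continuous R _)).
  by move=> ts; exact: (cvg_pair (cl ts) cvg_snd).
- move=> [z s]; have [t st tz] := coord_liftable z.
  exists (SigSub (mem_set st), s); congr pair; apply: coord_inj => k.
  by rewrite cell_mkE -tz.
- apply: cell_continuous => k.
  have -> : (fun ts => coord ((cell_slide \o q) ts) k) =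
      (fun ts => collapse (spread (set_val ts.1) (1 - set_val ts.2) k)).
    apply/funext => -[t s]; apply: coord_cell_slide; first exact: set_valP.
    by move=> l; rewrite cell_mkE.
  move=> ts.
  have csp := @spread_continuous A (fun ts => set_val ts.1) _ ct cs k ts.
  exact: (continuous_comp csp (@collapse_continuous R _)).
Qed.

End deformation.

(** * The two faces as a wedge inside the cell *)

Section cell_wedge.
Variables (R : realType) (m n : nat).
Local Open Scope ring_scope.

Lemma cell_slide_id z (s : interval R) :
  gap (lift_of z) = 0 -> cell_slide (z, s) = z :> cell R (m + n).
Proof.
move=> gz; apply: coord_inj => k.
rewrite (coord_cell_slide _ (simplex_lift_of z) (collapse_lift_of z)).
by rewrite spread_gap0 ?gz ?mulr0 ?collapse_lift_of //; exact: simplex_lift_of.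
Qed.

Lemma lift_of01 (z : cell R (m + n)) k : coord z k = basept (circle R) ->
  lift_of z k = 0 \/ lift_of z k = 1.
Proof.
move=> zk; have [t01 _] := simplex_lift_of z.
have : collapse (lift_of z k) = collapse 0.
  by rewrite collapse_lift_of zk collapse01 //; left.
have /collapse_inj inj := t01 k.
by case/inj => [|->|[]]; [rewrite lexx ler01|left|].
Qed.

Lemma cell_slide_front (z : cell R (m + n)) s :
  (forall i, coord z (lshift n i) = basept (circle R)) -> cell_slide (z, s) = z.
Proof.
move=> zb; apply/cell_slide_id/gap_front01; first exact: simplex_lift_of.
by move=> i; apply: lift_of01.
Qed.

Lemma cell_slide_back (z : cell R (m + n)) s :
  (forall j, coord z (rshift m j) = basept (circle R)) -> cell_slide (z, s) = z.
Proof.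
move=> zb; apply/cell_slide_id/gap_back01; first exact: simplex_lift_of.
by move=> i; apply: lift_of01.
Qed.

Lemma cell_slide_basept s :
  cell_slide (basept (cell R (m + n)), s) = basept (cell R (m + n)).
Proof. by apply: cell_slide_front => i; exact: coord_basept. Qed.

Lemma cell_slide1 (z : cell R (m + n)) s :
  set_val s = 1 -> cell_slide (z, s) = z.
Proof.
move=> s1; apply: coord_inj => k.
rewrite (coord_cell_slide _ (simplex_lift_of z) (collapse_lift_of z)) s1.
rewrite subrr spread_gap0 ?mul0r ?collapse_lift_of //.
exact: simplex_lift_of.
Qed.

Lemma zero_in_interval : (0 : R) \in (`[0, 1]%classic : set R).
Proof. by rewrite inE /= in_itv /= lexx ler01. Qed.

Definition interval0 : interval R := SigSub zero_in_interval.

Lemma squeeze_continuous :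
  continuous (fun z : cell R (m + n) => cell_slide (z, interval0)).
Proof.
move=> z; exact: (continuous_comp (@section_pair_continuous _ _ interval0 z)
  (@cell_slide_continuous R m n _)).
Qed.

Definition squeeze : based_map (cell R (m + n)) (cell R (m + n)) :=
  @mk_based _ _ (mkcts squeeze_continuous) (cell_slide_basept interval0).

Lemma lshift_homo : {homo @lshift m n : x y / (x <= y)%O}.
Proof. by []. Qed.

Lemma rshift_homo : {homo @rshift m n : x y / (x <= y)%O}.
Proof. by move=> x y; rewrite !leEord /= leq_add2l. Qed.

(** Dropping coordinates alone already retracts onto the face; squeezing first ensures that at each
    point one of the two retractions gives the base point. *)
Definition front_retract : based_map (cell R (m + n)) (cell R m) :=
  based_comp (degeneracy R (mk_omorph lshift_homo)) squeeze.

Definition back_retract : based_map (cell R (m + n)) (cell R n) :=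
  based_comp (degeneracy R (mk_omorph rshift_homo)) squeeze.

Lemma coord_front_retract z i : coord (map_of front_retract z) i =
  coord (cell_slide (z, interval0)) (lshift n i).
Proof. exact: coord_cell_map. Qed.

Lemma coord_back_retract z j : coord (map_of back_retract z) j =
  coord (cell_slide (z, interval0)) (rshift m j).
Proof. exact: coord_cell_map. Qed.

Lemma front_face_slide x s :
  cell_slide (map_of (front_face R m n) x, s) = map_of (front_face R m n) x.
Proof. by apply: cell_slide_back => j; rewrite coord_cell_map splitE. Qed.

Lemma back_face_slide x s :
  cell_slide (map_of (back_face R m n) x, s) = map_of (back_face R m n) x.
Proof. by apply: cell_slide_front => j; rewrite coord_cell_map splitE. Qed.

Lemma front_back_homotopy_equivalence (B : based_space) :
  homotopy_equivalence R
    (pair_space (precomp B (front_face R m n)) (precomp B (back_face R m n))).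
Proof.
have s0E s : set_val s = 0 -> s = interval0 by move=> s0; exact: val_inj.
apply: (@wedge_retract_homotopy_equivalence R _ _ _ B _ _
  front_retract back_retract (@cell_slide R m n)).
- move=> x; apply: coord_inj => i.
  by rewrite coord_front_retract front_face_slide coord_cell_map splitE.
- move=> x; apply: coord_inj => i.
  rewrite coord_back_retract front_face_slide coord_cell_map splitE.
  by rewrite coord_basept.
- move=> x; apply: coord_inj => i.
  rewrite coord_front_retract back_face_slide coord_cell_map splitE.
  by rewrite coord_basept.
- move=> x; apply: coord_inj => i.
  by rewrite coord_back_retract back_face_slide coord_cell_map splitE.
(* At full spread one block is clamped to its end, so its coordinates collapse to the base point. *)
- move=> z; have slideE := coord_cell_slide interval0
    (simplex_lift_of z) (collapse_lift_of z).
  case: (spread1 (simplex_lift_of z)) => tz; [left|right];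
    apply: coord_inj => i; rewrite coord_basept.
    by rewrite coord_front_retract slideE subr0 tz collapse01 //; left.
  by rewrite coord_back_retract slideE subr0 tz collapse01 //; right.
- exact: cell_slide_continuous.
- exact: cell_slide1.
(* The first block agrees by definition of the retraction; in the second, [zb] says that the
   squeezed point has base point coordinates, as the front face does. *)
- move=> z s /s0E -> zb; apply: coord_inj; apply: ord_split => i;
    rewrite coord_cell_map splitE ?coord_front_retract //.
  by rewrite -coord_back_retract zb coord_basept.
- move=> z s /s0E -> zb; apply: coord_inj; apply: ord_split => i;
    rewrite coord_cell_map splitE ?coord_back_retract //.
  by rewrite -coord_front_retract zb coord_basept.
- exact: cell_slide_basept.
Qed.

End cell_wedge.

(** * The unit condition and the natural homotopy monoid structure *)

Lemma cell0_all_equal (R : realType) (x y : cell R 0) : x = y.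
Proof. by apply: coord_inj => -[]. Qed.

Lemma loop_colax_homotopy_monoid (R : realType) (B : based_space) :
  is_homotopy_monoid R (loop_colax R B).
Proof.
split; last by move=> m n; exact: front_back_homotopy_equivalence.
have b0 : const_space (cell R 0) (basept B) (basept (cell R 0)) = basept B.
  by [].
(* The 0-cell is a point, so the constant map is the only element of [loop_obj R B 0]. *)
exists (const_space point_space (mk_based b0 : loop_obj R B 0)); split.
  apply: homotopic_refl => f; apply: based_map_ext => x.
  by rewrite (cell0_all_equal x (basept _)) !based_mapP.
by apply: homotopic_refl => -[].
Qed.

Theorem proposition4p1 (R : realType) :
  exists (X : based_space -> colax_functor Delta Top)
         (e : forall B : based_space, X B 1%N = loop_space R B)
         (theta : forall B C : based_space, based_map B C ->
                  monoidal_transformation (X B) (X C)),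
    (forall B : based_space, is_homotopy_monoid R (X B)) /\
    (forall (B : based_space) (n : nat),
       theta B B (based_id B) n = idm (X B n)) /\
    (forall (B C D : based_space) (g : based_map C D) (f : based_map B C)
            (n : nat),
       theta B D (based_comp g f) n = theta C D g n \oc theta B C f n) /\
    (forall (B C : based_space) (f : based_map B C),
       eq_mor (e C) \oc theta B C f 1%N
       = (loop_map R f : @mor Top (loop_space R B) (loop_space R C))
         \oc eq_mor (e B)).
Proof.
(* The 1-cell is the circle by definition, so the value at [1] is the loop space definitionally and
   both [eq_mor] are identities. *)
exists (loop_colax R), (fun=> erefl), (loop_trans R).
split; first exact: loop_colax_homotopy_monoid.
split; first by move=> B n; apply/continuousEP => h; exact: based_map_ext.
split; first by move=> *; apply/continuousEP => h; exact: based_map_ext.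
by move=> B C f; apply/continuousEP => h; exact: based_map_ext.
Qed.
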